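(* Let $\mathcal{C}$ be a class of $\lambda$-models having both the finite intersection property and the ultraproduct property. Then $\mathcal{C}$ has a minimal model, i.e. there exists $\mathbf{A}\in\mathcal{C}$ such that $\mathrm{Eq}(\mathbf{A})\subseteq \mathrm{Eq}(\mathbf{B})$ for every $\mathbf{B}\in\mathcal{C}$.
   Context: A combinatory algebra is a structure $\mathbf{A}=(A,\cdot,\mathbf{k},\mathbf{s})$ with a binary operation $\cdot$ (application, associating to the left) and distinguished elements (basic combinators) $\mathbf{k},\mathbf{s}$ satisfying $\mathbf{k}xy=x$ and $\mathbf{s}xyz=xz(yz)$. A $\lambda$-model is a combinatory algebra in which any two closed combinatory terms whose standard translations into $\lambda$-terms are $\beta$-convertible have the same value, and which satisfies the Meyer–Scott axiom: for all $a,b$, if $ax=bx$ for all $x$, then $\mathbf{1}a=\mathbf{1}b$, where $\mathbf{1}=\mathbf{s}(\mathbf{k}\mathbf{i})$ and $\mathbf{i}=\mathbf{s}\mathbf{k}\mathbf{k}$. (This is the usual notion, axiomatized over combinatory algebras by finitely many first-order sentences.) Closed $\lambda$-terms are interpreted in a $\lambda$-model via their standard translation into closed combinatory terms. $\mathrm{Eq}(\mathbf{A})$ denotes the equational theory of $\mathbf{A}$: the set of equations $M=N$ between closed $\lambda$-terms (equivalently, closed combinatory terms) such that $M$ and $N$ have the same interpretation in $\mathbf{A}$. For a non-empty set $I$, a family $\{\mathbf{A}_i\}_{i\in I}$ of $\lambda$-models and a proper ultrafilter $U$ of $\mathcal{P}(I)$, the ultraproduct $(\prod_{i\in I}\mathbf{A}_i)/U$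 is the quotient of the product combinatory algebra by the congruence $a\sim_U b \iff \{i\in I : a(i)=b(i)\}\in U$; it is again a $\lambda$-model. An embedding is an injective map preserving application and the basic combinators $\mathbf{k},\mathbf{s}$. A class $\mathcal{C}$ of $\lambda$-models has the finite intersection property if for all $\mathbf{A},\mathbf{B}\in\mathcal{C}$ there exists $\mathbf{C}\in\mathcal{C}$ with $\mathrm{Eq}(\mathbf{C})\subseteq\mathrm{Eq}(\mathbf{A})\cap\mathrm{Eq}(\mathbf{B})$. It has the ultraproduct property if for every non-empty family $\{\mathbf{A}_i\}_{i\in I}$ of members of $\mathcal{C}$ and every proper ultrafilter $U$ of $\mathcal{P}(I)$, the ultraproduct $(\prod_{i\in I}\mathbf{A}_i)/U$ can be embedded into a member of $\mathcal{C}$.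
   Formalization: The class C is additionally assumed to be non-empty; the empty class has both properties vacuously but contains no minimal model. *)

(* Defs.v *)
From HB Require Import structures.
From mathcomp Require Import all_boot.
From mathcomp Require Import boolp classical_sets filter.

Set Implicit Arguments.
Unset Strict Implicit.
Unset Printing Implicit Defensive.

Local Open Scope classical_set_scope.
Local Open Scope quotient_scope.

HB.mixin Record isCombAlg (A : Type) := {
  appl : A -> A -> A;
  kk : A;
  ss : A;
  kkE : forall x y : A, appl (appl kk x) y = x;
  ssE : forall x y z : A, appl (appl (appl ss x) y) z = appl (appl x z) (appl y z)
}.

#[short(type="combAlgType")]
HB.structure Definition CombAlg := {A of isCombAlg A}.

Notation "x @@ y" := (appl x y) (at level 40, left associativity).

(** Combinatory terms and lambda-terms are well scoped, with free variables in
    'I_n (de Bruijn indices); [cterm 0] and [lterm 0] are the closed ones. *)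

Inductive cterm (n : nat) : Type :=
| CVar of 'I_n
| CK
| CS
| CApp of cterm n & cterm n.

Arguments CK {n}.
Arguments CS {n}.

Inductive lterm (n : nat) : Type :=
| LVar of 'I_n
| LApp of lterm n & lterm n
| LLam of lterm n.+1.

Definition scons n (T : Type) (u : T) (f : 'I_n -> T) (i : 'I_n.+1) : T :=
  if unlift ord0 i is Some j then f j else u.

Fixpoint rename n m (f : 'I_n -> 'I_m) (t : lterm n) {struct t} : lterm m :=
  match t with
  | LVar i => LVar (f i)
  | LApp u v => LApp (rename f u) (rename f v)
  | LLam u => LLam (rename (scons ord0 (fun i => lift ord0 (f i))) u)
  end.

Fixpoint subst n m (f : 'I_n -> lterm m) (t : lterm n) {struct t} : lterm m :=
  match t with
  | LVar i => f i
  | LApp u v => LApp (subst f u) (subst f v)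
  | LLam u =>
      LLam (subst (scons (LVar ord0) (fun i => rename (lift ord0) (f i))) u)
  end.

Definition subst0 n (u : lterm n) (t : lterm n.+1) : lterm n :=
  subst (scons u (@LVar n)) t.

Inductive beta_conv : forall n, lterm n -> lterm n -> Prop :=
| beta_beta n (t : lterm n.+1) (u : lterm n) :
    beta_conv (LApp (LLam t) u) (subst0 u t)
| beta_app n (t t' u u' : lterm n) :
    beta_conv t t' -> beta_conv u u' -> beta_conv (LApp t u) (LApp t' u')
| beta_lam n (t t' : lterm n.+1) :
    beta_conv t t' -> beta_conv (LLam t) (LLam t')
| beta_refl n (t : lterm n) : beta_conv t t
| beta_sym n (t u : lterm n) : beta_conv t u -> beta_conv u t
| beta_trans n (t u v : lterm n) :
    beta_conv t u -> beta_conv u v -> beta_conv t v.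

Definition lamK n : lterm n := LLam (LLam (LVar (lift ord0 ord0))).

Definition lamS n : lterm n :=
  let x := LVar (lift ord0 (lift ord0 ord0)) in
  let y := LVar (lift ord0 ord0) in
  let z := LVar ord0 in
  LLam (LLam (LLam (LApp (LApp x z) (LApp y z)))).

Fixpoint lterm_of_cterm n (t : cterm n) : lterm n :=
  match t with
  | CVar i => LVar i
  | CK => lamK n
  | CS => lamS n
  | CApp u v => LApp (lterm_of_cterm u) (lterm_of_cterm v)
  end.

Definition CI {n} : cterm n := CApp (CApp CS CK) CK.

(** [strengthen t] is [t] with variable 0 discarded from the scope, when that
    variable does not occur in [t], and [None] when it does. *)
Fixpoint strengthen n (t : cterm n.+1) : option (cterm n) :=
  match t with
  | CVar i => omap (@CVar n) (unlift ord0 i)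
  | CK => Some CK
  | CS => Some CS
  | CApp u v =>
      if strengthen u is Some u' then omap (CApp u') (strengthen v) else None
  end.

(** Bracket abstraction of variable 0:
      [x]x = i,  [x]P = k P if x is not in P,  [x](P Q) = s ([x]P) ([x]Q).
    Under [None], the only leaf that can arise is variable 0 itself. *)
Fixpoint bracket n (t : cterm n.+1) : cterm n :=
  if strengthen t is Some t' then CApp CK t' else
  if t is CApp u v then CApp (CApp CS (bracket u)) (bracket v) else CI.

Fixpoint cterm_of_lterm n (t : lterm n) : cterm n :=
  match t with
  | LVar i => CVar i
  | LApp u v => CApp (cterm_of_lterm u) (cterm_of_lterm v)
  | LLam u => bracket (cterm_of_lterm u)
  end.

Fixpoint ceval (A : combAlgType) n (e : 'I_n -> A) (t : cterm n) : A :=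
  match t with
  | CVar i => e i
  | CK => kk
  | CS => ss
  | CApp u v => ceval e u @@ ceval e v
  end.

(** The environment is irrelevant here, since 'I_0 is empty. *)
Definition cvalue (A : combAlgType) (t : cterm 0) : A := ceval (fun=> kk) t.

Definition interp (A : combAlgType) (M : lterm 0) : A :=
  cvalue A (cterm_of_lterm M).

Definition Eq (A : combAlgType) : set (lterm 0 * lterm 0) :=
  [set e | interp A e.1 = interp A e.2].

Definition ii (A : combAlgType) : A := ss @@ kk @@ kk.
Definition one (A : combAlgType) : A := ss @@ (kk @@ ii A).

HB.mixin Record CombAlg_isLambdaModel A of CombAlg A := {
  beta_sound : forall t u : cterm 0,
    beta_conv (lterm_of_cterm t) (lterm_of_cterm u) -> cvalue A t = cvalue A u;
  meyer_scott : forall a b : A,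
    (forall x, a @@ x = b @@ x) -> one A @@ a = one A @@ b
}.

#[short(type="lambdaModelType")]
HB.structure Definition LambdaModel :=
  {A of CombAlg A & CombAlg_isLambdaModel A}.

Definition embedding (A B : combAlgType) (f : A -> B) : Prop :=
  [/\ injective f,
      forall x y, f (x @@ y) = f x @@ f y,
      f kk = kk
    & f ss = ss].

Definition product (I : Type) (A : I -> combAlgType) : Type := forall i, A i.

Section Product.
Variables (I : Type) (A : I -> combAlgType).

HB.instance Definition _ := gen_eqMixin (product A).
HB.instance Definition _ := gen_choiceMixin (product A).

Let papp (a b : product A) : product A := fun i => a i @@ b i.
Let pk : product A := fun=> kk.
Let ps : product A := fun=> ss.

Fact product_kkE x y : papp (papp pk x) y = x.
Proof. by apply: functional_extensionality_dep => i; exact: kkE. Qed.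

Fact product_ssE x y z :
  papp (papp (papp ps x) y) z = papp (papp x z) (papp y z).
Proof. by apply: functional_extensionality_dep => i; exact: ssE. Qed.

HB.instance Definition _ := isCombAlg.Build (product A) product_kkE product_ssE.

End Product.

Section Ultraproduct.
Variables (I : Type) (A : I -> combAlgType).
Variables (U : set_system I) (UU : UltraFilter U).

Definition ultra_rel : rel (product A) :=
  fun a b => `[< U [set i | a i = b i] >].

Fact ultra_rel_refl : reflexive ultra_rel.
Proof. by move=> a; apply/asboolP; apply: filterE. Qed.

Fact ultra_rel_sym : symmetric ultra_rel.
Proof.
by move=> a b; apply/asboolP/asboolP; apply: filterS => i /= ->.
Qed.

Fact ultra_rel_trans : transitive ultra_rel.
Proof.
move=> b a c /asboolP Uab /asboolP Ubc; apply/asboolP.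
by apply: filterS2 Uab Ubc => i /= -> ->.
Qed.

Canonical ultra_equiv :=
  EquivRel ultra_rel ultra_rel_refl ultra_rel_sym ultra_rel_trans.

Definition ultraproduct : Type := {eq_quot ultra_equiv}.

HB.instance Definition _ := EqQuotient.on ultraproduct.

Let uapp (x y : ultraproduct) : ultraproduct :=
  \pi_ultraproduct ((repr x : product A) @@ repr y).
Let uk : ultraproduct := \pi_ultraproduct (kk : product A).
Let us : ultraproduct := \pi_ultraproduct (ss : product A).

Fact pi_uapp (a b : product A) :
  uapp (\pi a) (\pi b) = \pi_ultraproduct (a @@ b : product A).
Proof.
have repr_pi (c : product A) : U [set i | repr (\pi_ultraproduct c) i = c i].
  by apply/asboolP; apply/(@eqquotP _ ultra_equiv ultraproduct); rewrite reprK.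
apply/(@eqquotP _ ultra_equiv ultraproduct)/asboolP.
by apply: filterS2 (repr_pi a) (repr_pi b) => i /= ea eb; congr (_ @@ _).
Qed.

Fact ultraproduct_kkE x y : uapp (uapp uk x) y = x.
Proof.
elim/quotW: x => a; elim/quotW: y => b.
by rewrite (pi_uapp kk a) (pi_uapp (kk @@ a) b) kkE.
Qed.

Fact ultraproduct_ssE x y z :
  uapp (uapp (uapp us x) y) z = uapp (uapp x z) (uapp y z).
Proof.
elim/quotW: x => a; elim/quotW: y => b; elim/quotW: z => c.
rewrite (pi_uapp ss a) (pi_uapp (ss @@ a) b) (pi_uapp (ss @@ a @@ b) c).
by rewrite (pi_uapp a c) (pi_uapp b c) (pi_uapp (a @@ c) (b @@ c)) ssE.
Qed.

HB.instance Definition _ :=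
  isCombAlg.Build ultraproduct ultraproduct_kkE ultraproduct_ssE.

End Ultraproduct.

Definition finite_intersection_property (C : set lambdaModelType) : Prop :=
  forall A B : lambdaModelType, C A -> C B ->
    exists2 D : lambdaModelType, C D & Eq D `<=` Eq A `&` Eq B.

Definition ultraproduct_property (C : set lambdaModelType) : Prop :=
  forall (I : Type) (A : I -> lambdaModelType) (U : set_system I)
      (UU : UltraFilter U),
    inhabited I -> (forall i, C (A i)) ->
    exists2 B : lambdaModelType, C B &
      exists f : ultraproduct (fun i => A i) UU -> B, embedding f.

(* Main.v *)
Require Import Defs.
From mathcomp Require Import all_boot.
From mathcomp Require Import boolp classical_sets filter.

Local Open Scope classical_set_scope.

(** Let T be the set of equations true in all of C. The finite intersection
    property gives, for each finite set F of equations, a member of C in which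
    every equation of F outside T fails. Take the ultraproduct of these models
    along an ultrafilter on the finite sets F containing all the cones
    [{G | F is included in G}]. An equation e true in the ultraproduct is true
    in the model of some F containing e, so e belongs to T; and a member of C
    into which the ultraproduct embeds satisfies the same equations. *)

Lemma ceval_embedding {A B : combAlgType} (f : A -> B) :
  embedding f -> forall n (e : 'I_n -> A) (t : cterm n),
  ceval (f \o e) t = f (ceval e t).
Proof.
by move=> [_ fD fk fs] n e; elim=> [i| | |u IHu v IHv] //=; rewrite fD IHu IHv.
Qed.

(** A homomorphism commutes with the values of closed terms, so it preserves equations; injectivity
    reflects them. *)
Lemma Eq_embedding {A B : combAlgType} (f : A -> B) :
  embedding f -> Eq B = Eq A.
Proof.
move=> femb; have [f_inj _ fk _] := femb.
have interpE M : interp B M = f (interp A M).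
  by rewrite /interp /cvalue -(ceval_embedding _ femb) /comp fk.
apply/seteqP; split=> -[M N] /=; rewrite /Eq /= !interpE; first exact: f_inj.
by move=> ->.
Qed.

Section UltraproductTheory.
Variables (I : Type) (A : I -> combAlgType).
Variables (U : set_system I) (UU : UltraFilter U).

Local Notation pi := (\pi_(ultraproduct A UU))%qT.

Lemma ceval_product n (e : 'I_n -> product A) (t : cterm n) i :
  ceval e t i = ceval (fun j => e j i) t.
Proof. by elim: t => //= u <- v <-. Qed.

Lemma ceval_ultraproduct n (e : 'I_n -> product A) (t : cterm n) :
  ceval (fun j => pi (e j)) t = pi (ceval e t).
Proof. by elim: t => //= u -> v ->; exact: pi_uapp. Qed.

(* Los's theorem, for equations between closed terms. *)
Lemma Eq_ultraproduct M N :
  Eq (ultraproduct A UU) (M, N) <-> U [set i | Eq (A i) (M, N)].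
Proof.
have interpE P :
    interp (ultraproduct A UU) P = pi (fun i => interp (A i) P).
  have -> : (fun i => interp (A i) P) = interp (product A) P.
    by apply: functional_extensionality_dep => i; rewrite [RHS]ceval_product.
  exact: ceval_ultraproduct.
rewrite /Eq /= !interpE; split.
  by move/(@eqquotP _ (ultra_equiv A UU) (ultraproduct A UU))/asboolP.
by move=> h; apply/(@eqquotP _ (ultra_equiv A UU) (ultraproduct A UU))/asboolP.
Qed.

End UltraproductTheory.

(** Sequences code finite sets. The cones form a proper filter base: that of [s ++ t] lies in those
    of [s] and [t], and [s] lies in its own cone. *)
Lemma ultrafilter_of_cones (T : choiceType) :
  exists2 U : set_system (seq T), UltraFilter U &
    forall x, U [set s | x \in s].
Proof.
pose cone (s : seq T) := [set s' : seq T | {subset s <= s'}].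
have cone_proper : ProperFilter (filter_from setT cone).
  apply: filter_from_proper; last by move=> s _; exists s => x.
  apply: filter_from_filter; first by exists [::].
  move=> s t _ _; exists (s ++ t) => // r str.
  by split=> x xs; apply: str; rewrite mem_cat xs ?orbT.
have [U [UU coneU]] := ultraFilterLemma cone_proper.
exists U => // x; apply: coneU; exists [:: x] => // s; apply.
exact: mem_head.
Qed.

(** Induction on [s]: if the new equation fails in some [B] of [C], it fails in any [D] with [Eq D]
    inside [Eq A] and [Eq B], and the earlier refutations in [A] persist in [D]. *)
Lemma fip_refute_seq (C : set lambdaModelType) :
  C !=set0 -> finite_intersection_property C ->
  forall s : seq {classic (lterm 0 * lterm 0)},
  exists A : lambdaModelType, C A /\
    forall x, x \in s -> Eq A x -> forall B : lambdaModelType, C B -> Eq B x.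
Proof.
move=> [A0 CA0] Cfip; elim=> [|x s [A [CA As]]]; first by exists A0.
have [xT|/existsNP[B /not_implyP[CB Bx]]] :=
  pselect (forall B : lambdaModelType, C B -> Eq B x).
  by exists A; split=> // y; rewrite inE => /predU1P[->|/As].
have [D CD DAB] := Cfip _ _ CA CB.
exists D; split=> // y; rewrite inE => /predU1P[->|ys] /DAB[Ay By] //.
exact: As.
Qed.

Theorem theorem3p1 (C : set lambdaModelType) (C_neq0 : C !=set0)
    (C_fip : finite_intersection_property C)
    (C_up : ultraproduct_property C) :
  exists2 A : lambdaModelType, C A &
    forall B : lambdaModelType, C B -> Eq A `<=` Eq B.
Proof.
have [A hA] := choice (@fip_refute_seq C C_neq0 C_fip).
have [U UU coneU] := ultrafilter_of_cones {classic (lterm 0 * lterm 0)}.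
have [|i|D CD [f femb]] := C_up _ A U UU; first by constructor; exact: [::].
  by have [] := hA i.
exists D => // B CB [M N]; rewrite (Eq_embedding _ femb).
move=> /Eq_ultraproduct UMN.
(* Members of [U] are non-empty, so some [s] contains [(M, N)] while [A s] satisfies it. *)
have [s [sMN AsMN]] := filter_ex (filterI (coneU (M, N)) UMN).
by have [_ /(_ (M, N) sMN AsMN)] := hA s; apply.
Qed.
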